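(* If $u_1\neq u_2$, then every $f\in C_c^2(S^2;D_1)$ can be recovered from (i.e. is uniquely determined within $C_c^2(S^2;D_1)$ by) any one of the following three combinations of functions on $\mathbb{R}^2$: 1. $\mathcal{T}f$, $\mathcal{T}^1f$ and $\mathcal{L}f$; 2. $\mathcal{M}f$, $\mathcal{M}^1f$ and $\mathcal{L}f$; 3. $\mathcal{M}f$, $\mathcal{M}^1f$ and $\mathcal{T}f$.
   Context: $D_1\subset\mathbb{R}^2$ is an open disc of radius $r_1>0$ centered at the origin. $C_c^2(S^2;D_1)$ is the space of symmetric $2$-tensor fields $f=(f_{ij})_{i,j=1,2}$, $f_{12}=f_{21}$, whose components are twice continuously differentiable and compactly supported in $D_1$ (extended by zero to $\mathbb{R}^2$). For symmetric $2$-tensors, $\langle f,g\rangle=f_{11}g_{11}+2f_{12}g_{12}+f_{22}g_{22}$. For vectors $a,b\in\mathbb{R}^2$, $(a\odot b)_{ij}=\frac12(a_ib_j+a_jb_i)$, $a^2=a\odot a$, and $a^\perp=(-a_2,a_1)$. For a unit vector $a$, an integer $k\ge0$ and a compactly supported function $h$, $\mathcal{X}^k_a h(x)=\int_0^\infty h(x+ta)\,t^k\,dt$. Fix unit vectors $u=(u_1,u_2)$ and $v=(-u_1,u_2)$ with $u_1,u_2>0$ (so $u,v$ are linearly independent, and they are orthogonal exactly when $u_1=u_2$). The $k$-th moment longitudinal, transverse and mixed V-line transforms are the functions on $\mathbb{R}^2$ $$\mathcal{L}^kf=\mathcal{X}^k_u\langle f,u^2\rangle+\mathcal{X}^k_v\langle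 f,v^2\rangle,\quad \mathcal{T}^kf=\mathcal{X}^k_u\langle f,(u^\perp)^2\rangle+\mathcal{X}^k_v\langle f,(v^\perp)^2\rangle,\quad \mathcal{M}^kf=\mathcal{X}^k_u\langle f,u\odot u^\perp\rangle+\mathcal{X}^k_v\langle f,v\odot v^\perp\rangle,$$ and $\mathcal{L}=\mathcal{L}^0$, $\mathcal{T}=\mathcal{T}^0$, $\mathcal{M}=\mathcal{M}^0$. (The values of the functions in each of the three combinations on a sufficiently large closed disc centered at the origin determine them on all of $\mathbb{R}^2$.) *)

(* Defs.v *)
From Stdlib Require Import Reals List.
From Coquelicot Require Import Coquelicot.
Open Scope R_scope.

Notation vec := (R * R)%type (only parsing).

(* A symmetric 2-tensor is stored by its independent components; the entry
   (2,1) is [t12] as well. *)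
Record sym2 := Sym2 { t11 : R; t12 : R; t22 : R }.

(* The factor 2 accounts for the entries (1,2) and (2,1). *)
Definition pairing (f g : sym2) : R :=
  t11 f * t11 g + 2 * (t12 f * t12 g) + t22 f * t22 g.

Definition odot (a b : vec) : sym2 :=
  Sym2 (/ 2 * (fst a * fst b + fst a * fst b))
       (/ 2 * (fst a * snd b + snd a * fst b))
       (/ 2 * (snd a * snd b + snd a * snd b)).

Definition perp (a : vec) : vec := (- snd a, fst a).

(* Coquelicot's norm on a product is the Euclidean one. *)
Definition open_disc (r : R) (x : vec) : Prop := norm x < r.

Definition closure (A : vec -> Prop) (x : vec) : Prop :=
  ~ locally x (fun y => ~ A y).

Definition support (h : vec -> R) : vec -> Prop :=
  closure (fun x => h x <> 0).

Definition compact_set (K : vec -> Prop) : Prop :=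
  forall (I : Type) (U : I -> vec -> Prop),
    (forall i, open (U i)) ->
    (forall x, K x -> exists i, U i x) ->
    exists l : list I, forall x, K x -> exists i, In i l /\ U i x.

Definition compactly_supported_in (D : vec -> Prop) (h : vec -> R) : Prop :=
  compact_set (support h) /\ forall x, support h x -> D x.

(* [ex_diff_n] asks for existence and joint continuity of all iterated partial
   derivatives up to the given order. *)
Definition C2 (h : vec -> R) : Prop :=
  forall x1 x2, ex_diff_n (fun y1 y2 => h (y1, y2)) 2 x1 x2.

Definition C2c (D : vec -> Prop) (h : vec -> R) : Prop :=
  C2 h /\ compactly_supported_in D h.

Definition C2c_tensor (D : vec -> Prop) (f : vec -> sym2) : Prop :=
  C2c D (fun x => t11 (f x)) /\
  C2c D (fun x => t12 (f x)) /\
  C2c D (fun x => t22 (f x)).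

Definition Xray (k : nat) (a : vec) (h : vec -> R) (x : vec) : R :=
  RInt_gen (fun t => h (plus x (scal t a)) * t ^ k)
           (at_point 0) (Rbar_locally p_infty).

Definition Ltrans (k : nat) (u v : vec) (f : vec -> sym2) (x : vec) : R :=
  Xray k u (fun y => pairing (f y) (odot u u)) x +
  Xray k v (fun y => pairing (f y) (odot v v)) x.

Definition Ttrans (k : nat) (u v : vec) (f : vec -> sym2) (x : vec) : R :=
  Xray k u (fun y => pairing (f y) (odot (perp u) (perp u))) x +
  Xray k v (fun y => pairing (f y) (odot (perp v) (perp v))) x.

Definition Mtrans (k : nat) (u v : vec) (f : vec -> sym2) (x : vec) : R :=
  Xray k u (fun y => pairing (f y) (odot u (perp u))) x +
  Xray k v (fun y => pairing (f y) (odot v (perp v))) x.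

(* Main.v *)
Require Import Defs.
From Stdlib Require Import Reals List Lra.
From Coquelicot Require Import Coquelicot.
Open Scope R_scope.

(** Let t = f - g. Each transform has the form X_u phi + X_v psi, where phi and
    psi are the components of t along two fixed symmetric tensors, and in the
    coordinates x = p u + q v the ray transform of order k in the direction u is
    the tail moment int_p^B phi(s,q) (s-p)^k ds, B being a bound beyond which t
    vanishes ([is_RInt_gen_line]).

    Suppose that the combinations of order 0 and 1 both vanish. Put
    A = X_u phi = - X_v psi and G = X^1_u phi = - X^1_v psi. Differentiating the
    tail moments gives d_p G = d_q G = - A: hence G is constant along u - v. It
    vanishes for p >= B, so G = 0, then A = 0, and then phi = psi = 0
    ([opposite_moments_eq_0]).

    A single combination of order 0 suffices if phi = psi: then d_p A = - phi and
    d_q A = phi, so that A is constant along u + v, and again A = 0 and phi = 0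
    ([opposite_integrals_eq_0]).

    The first fact, applied to the transform of which both moments are known,
    yields two linear equations on t at each point. For the transverse
    components they say t12 = 0 and u2^2 t11 + u1^2 t22 = 0, for the mixed ones
    t12 = 0 and t11 = t22 (as u1 <> u2). Since t12 = 0 and u, v are mirror
    images of each other, the two components in the third transform agree, so the
    second fact makes them vanish. This third equation settles the matter: in the
    first case it reads u1^2 t11 + u2^2 t22 = 0, which is independent of
    u2^2 t11 + u1^2 t22 = 0 because u1^4 <> u2^4; in the others it reads
    (u1^2 + u2^2) t11 = 0. [sym2_recovery] is this reduction to linear algebra. *)

(** * Tail moments on the line *)

Definition tail_moment (k : nat) (f : R -> R) (b p : R) : R :=
  RInt (fun s => f s * (s - p) ^ k) p b.

Lemma ex_RInt_continuous_global (f : R -> R) (a b : R) :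
  (forall s, continuous f s) -> ex_RInt f a b.
Proof.
  intros Hf; apply (ex_RInt_continuous (V := R_CompleteNormedModule)).
  intros; apply Hf.
Qed.

Lemma continuous_weighted (k : nat) (f : R -> R) (p : R) :
  (forall s, continuous f s) ->
  forall s, continuous (fun s => f s * (s - p) ^ k) s.
Proof.
  intros Hf s.
  apply (continuous_mult (K := R_AbsRing) f (fun s => (s - p) ^ k)); [apply Hf|].
  apply (ex_derive_continuous (V := R_NormedModule)).
  now auto_derive.
Qed.

Lemma is_derive_RInt_lower (f : R -> R) (b p : R) :
  (forall s, continuous f s) ->
  is_derive (fun p => RInt f p b) p (- f p).
Proof.
  intros Hf.
  apply (is_derive_RInt' (V := R_NormedModule) f (fun p => RInt f p b) p b).
  - apply filter_forall; intros y.
    apply (RInt_correct (V := R_CompleteNormedModule)).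
    now apply ex_RInt_continuous_global.
  - apply Hf.
Qed.

Lemma tail_moment_0 (f : R -> R) (b p : R) :
  tail_moment 0 f b p = RInt f p b.
Proof.
  unfold tail_moment; apply RInt_ext; intros; simpl; ring.
Qed.

Lemma is_derive_tail_moment_0 (f : R -> R) (b p : R) :
  (forall s, continuous f s) ->
  is_derive (tail_moment 0 f b) p (- f p).
Proof.
  intros Hf.
  apply is_derive_ext with (fun p => RInt f p b).
  - intros; symmetry; apply tail_moment_0.
  - now apply is_derive_RInt_lower.
Qed.

Lemma tail_moment_1 (f : R -> R) (b p : R) :
  (forall s, continuous f s) ->
  tail_moment 1 f b p = RInt (fun s => f s * s) p b - p * RInt f p b.
Proof.
  intros Hf; unfold tail_moment.
  assert (H1 : ex_RInt (fun s => f s * s) p b).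
  { apply ex_RInt_ext with (fun s => f s * (s - 0) ^ 1).
    - intros; simpl; ring.
    - now apply ex_RInt_continuous_global, continuous_weighted. }
  assert (H2 := ex_RInt_continuous_global f p b Hf).
  apply (is_RInt_unique (V := R_CompleteNormedModule)).
  apply is_RInt_ext with (fun s => minus (f s * s) (scal p (f s))).
  - intros; unfold minus, plus, opp, scal; simpl; unfold mult; simpl; ring.
  - apply (is_RInt_minus (V := R_NormedModule) (fun s => f s * s) (fun s => scal p (f s))).
    + now apply (RInt_correct (V := R_CompleteNormedModule)).
    + apply (is_RInt_scal (V := R_NormedModule)).
      now apply (RInt_correct (V := R_CompleteNormedModule)).
Qed.

(** Expanding (s - p) as in [tail_moment_1], the two boundary terms - f(p) p and
    + p f(p) cancel and only the derivative of the factor p is left. *)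
Lemma is_derive_tail_moment_1 (f : R -> R) (b p : R) :
  (forall s, continuous f s) ->
  is_derive (tail_moment 1 f b) p (- tail_moment 0 f b p).
Proof.
  intros Hf.
  assert (Hfs : forall s, continuous (fun s => f s * s) s).
  { intros s; apply (continuous_mult (K := R_AbsRing) f (fun s => s));
      [apply Hf | apply continuous_id]. }
  apply is_derive_ext with (fun p => RInt (fun s => f s * s) p b - p * RInt f p b).
  - intros; symmetry; now apply tail_moment_1.
  - rewrite tail_moment_0.
    evar_last.
    + apply (is_derive_minus (V := R_NormedModule)).
      * now apply is_derive_RInt_lower.
      * apply (is_derive_mult (K := R_AbsRing) (fun p : R => p) (fun p : R => RInt f p b));
          [apply is_derive_id | now apply is_derive_RInt_lower | intros; apply Rmult_comm].
    + unfold minus, plus, opp, mult, one; simpl; ring.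
Qed.

Lemma RInt_eq_0 (f : R -> R) (a b : R) :
  (forall s, Rmin a b < s < Rmax a b -> f s = 0) -> RInt f a b = 0.
Proof.
  intros Hf.
  rewrite (RInt_ext _ (fun _ => 0)) by apply Hf.
  rewrite RInt_const; apply (scal_zero_r (V := R_NormedModule)).
Qed.

Lemma tail_moment_eq_0 (k : nat) (f : R -> R) (b p : R) :
  (forall s, b <= s -> f s = 0) -> b <= p -> tail_moment k f b p = 0.
Proof.
  intros Hf Hp; apply RInt_eq_0.
  rewrite Rmin_right by lra; intros s Hs; rewrite Hf by lra; ring.
Qed.

(** * Ray transforms as tail moments *)

Ltac vec_ring :=
  apply injective_projections; repeat (progress (unfold plus, scal; simpl));
  unfold mult; simpl; ring.

(** The substitution t = s - p turns the ray from y + p a into the part s >= p of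
    the line through y. Since h vanishes on it for s >= b, the improper integral is a
    proper one over [p, b]; for p > b the oriented integral is over an interval
    where h vanishes, so no case distinction on p is needed. *)
Lemma is_RInt_gen_line (k : nat) (h : R * R -> R) (y a : R * R) (b p : R) :
  (forall x, continuous h x) ->
  (forall s, b <= s -> h (plus y (scal s a)) = 0) ->
  is_RInt_gen (fun t => h (plus (plus y (scal p a)) (scal t a)) * t ^ k)
    (at_point 0) (Rbar_locally p_infty)
    (tail_moment k (fun s : R => h (plus y (scal s a))) b p).
Proof.
  intros Hh Hb.
  set (f := fun s : R => h (plus y (scal s a))).
  assert (Hf : forall s, continuous f s).
  { intros s; unfold f.
    apply (continuous_comp (fun s : R => plus y (scal s a)) h); [|apply Hh].
    apply (continuous_plus (V := prod_NormedModule _ R_NormedModule R_NormedModule)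
             (fun _ => y) (fun s : R => scal s a)).
    - apply continuous_const.
    - apply (continuous_scal_l (V := prod_NormedModule _ R_NormedModule R_NormedModule)
               (fun s : R => s) a).
      apply continuous_id. }
  set (F := fun s => f s * (s - p) ^ k).
  assert (HF : forall s, continuous F s) by now apply continuous_weighted.
  assert (E : forall t : R,
    h (plus (plus y (scal p a)) (scal t a)) * t ^ k = F (t + p)).
  { intros t; unfold F, f.
    replace (t + p - p) with t by ring; do 2 f_equal.
    vec_ring. }
  (* The integrals over [0, T] already have the limit value once T > b - p. *)
  intros P HP.
  exists (fun t => t = 0) (fun t => b - p < t).
  - reflexivity.
  - exists (b - p); trivial.
  - intros t0 T -> HT; simpl.
    exists (tail_moment k f b p); split; [|now apply locally_singleton].
    apply (is_RInt_ext (fun t => F (t + p))).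
    { intros; symmetry; apply E. }
    assert (Htail : RInt F b (T + p) = 0).
    { apply RInt_eq_0; rewrite Rmin_left by lra; intros s Hs; unfold F, f.
      rewrite Hb by lra; ring. }
    replace (tail_moment k f b p) with (RInt F (0 + p) (T + p)).
    + apply (is_RInt_ext (fun t => scal 1 (F (t + p)))).
      { intros; apply (scal_one (V := R_NormedModule)). }
      apply (is_RInt_comp (V := R_CompleteNormedModule) F (fun t => t + p) (fun _ => 1)).
      * intros; apply HF.
      * intros; split; [auto_derive; trivial; ring | apply continuous_const].
    + unfold tail_moment; fold F.
      rewrite Rplus_0_l.
      rewrite <- (RInt_Chasles (V := R_CompleteNormedModule) F p b (T + p));
        try now apply ex_RInt_continuous_global.
      unfold plus; simpl; rewrite Htail; apply Rplus_0_r.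
Qed.

(** The transforms are improper integrals, total but not additive in general; here
    both converge. *)
Lemma Xray_line_minus (k : nat) (h1 h2 : R * R -> R) (y a : R * R) (b p : R) :
  (forall x, continuous h1 x) -> (forall x, continuous h2 x) ->
  (forall s, b <= s -> h1 (plus y (scal s a)) = 0) ->
  (forall s, b <= s -> h2 (plus y (scal s a)) = 0) ->
  tail_moment k (fun s : R => h1 (plus y (scal s a)) - h2 (plus y (scal s a))) b p =
  Xray k a h1 (plus y (scal p a)) - Xray k a h2 (plus y (scal p a)).
Proof.
  intros C1 C2 Z1 Z2.
  rewrite <- (is_RInt_gen_unique _ _ (is_RInt_gen_line k (fun x => h1 x - h2 x) y a b p
    (fun x => continuous_minus (V := R_NormedModule) h1 h2 x (C1 x) (C2 x))
    (fun s Hs => eq_trans (f_equal2 Rminus (Z1 s Hs) (Z2 s Hs)) (Rminus_diag 0)))).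
  unfold Xray.
  rewrite (is_RInt_gen_unique _ _ (is_RInt_gen_line k h1 y a b p C1 Z1)).
  rewrite (is_RInt_gen_unique _ _ (is_RInt_gen_line k h2 y a b p C2 Z2)).
  apply is_RInt_gen_unique.
  eapply is_RInt_gen_ext.
  2: exact (is_RInt_gen_minus _ _ _ _ (is_RInt_gen_line k h1 y a b p C1 Z1)
              (is_RInt_gen_line k h2 y a b p C2 Z2)).
  apply filter_forall; intros [t0 t1] t _.
  unfold minus, plus, opp; simpl; ring.
Qed.

(** * Transport along a line in the plane *)

Lemma is_derive_of_zero (f : R -> R) (x l : R) :
  (forall t, f t = 0) -> is_derive f x l -> l = 0.
Proof.
  intros Hf H.
  rewrite <- (is_derive_unique _ _ _ H), (Derive_ext _ (fun _ => 0)) by apply Hf.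
  apply Derive_const.
Qed.

(** The derivative of G in the direction (1, c) is a + c b = 0, and a line in this
    direction meets the half-plane p >= B for every slope c. *)
Lemma eq_0_of_constant_direction (G a b : R -> R -> R) (c B : R) :
  (forall p q, is_derive (fun p => G p q) p (a p q)) ->
  (forall p q, is_derive (fun q => G p q) q (b p q)) ->
  (forall p q, continuous (fun z : R * R => a (fst z) (snd z)) (p, q)) ->
  (forall p q, a p q + c * b p q = 0) ->
  (forall p q, B <= p -> G p q = 0) ->
  forall p q, G p q = 0.
Proof.
  intros Hp Hq Ha Hab HB p q.
  assert (H : forall s, is_derive (fun s => G (p + s) (q + c * s)) s zero).
  { intros s.
    assert (HF := is_derive_filterdiff G (p + s) (q + c * s) a _
              (filter_forall _ (fun z => Hp (fst z) (snd z)))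
              (Hq _ _) (Ha _ _)).
    unfold is_derive; eapply filterdiff_ext_lin.
    - apply (filterdiff_comp'_2 (K := R_AbsRing) (T := R_NormedModule)
               (U := R_NormedModule) (V := R_NormedModule) (W := R_NormedModule)
               (fun s => p + s) (fun s => q + c * s) G s
               (fun s => scal s 1) (fun s => scal s c)
               (fun x y => plus (scal x (a (p + s) (q + c * s)))
                                (scal y (b (p + s) (q + c * s))))).
      3: exact HF.
      + change (is_derive (fun s => p + s) s 1); auto_derive; trivial; ring.
      + change (is_derive (fun s => q + c * s) s c); auto_derive; trivial; ring.
    - intros y; unfold plus, scal, zero; simpl.
      unfold mult; simpl.
      transitivity (y * (a (p + s) (q + c * s) + c * b (p + s) (q + c * s)));
        [ring | rewrite Hab; ring]. }
  (* At parameter S the line has entered the half-plane. *)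
  set (S := Rabs (B - p) + 1).
  rewrite <- (HB (p + S) (q + c * S)).
  2: { assert (H0 := Rle_abs (B - p)); unfold S; lra. }
  replace (G p q) with (G (p + 0) (q + c * 0)) by (f_equal; ring).
  apply (eq_is_derive (V := R_NormedModule) (fun s => G (p + s) (q + c * s)) 0 S).
  - intros; apply H.
  - assert (H0 := Rabs_pos (B - p)); unfold S; lra.
Qed.

(** Joint continuity of the ray transform A = X_u phi: a locally bounded partial
    derivative in p makes A Lipschitz in p uniformly in q, while its continuity in q
    comes from the other expression - X_v psi. *)
Lemma continuous_of_partial (A a : R -> R -> R) (p q : R) :
  (forall p q, is_derive (fun p => A p q) p (a p q)) ->
  continuous (fun z : R * R => a (fst z) (snd z)) (p, q) ->
  continuous (fun q => A p q) q ->
  continuous (fun z : R * R => A (fst z) (snd z)) (p, q).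
Proof.
  intros HA Ha Hq.
  apply continuity_2d_pt_filterlim; intros eps.
  apply continuity_2d_pt_filterlim in Ha.
  destruct (Ha (mkposreal 1 Rlt_0_1)) as [d1 H1]; simpl in H1.
  apply continuity_pt_filterlim in Hq.
  assert (He : 0 < eps / 2) by (destruct eps; simpl; lra).
  destruct (Hq (eps / 2) He) as [d2 [Hd2 H2]]; simpl in H2; unfold R_dist in H2.
  set (M := Rabs (a p q) + 1).
  assert (HM : 0 < M) by (assert (H0 := Rabs_pos (a p q)); unfold M; lra).
  assert (Hd : 0 < Rmin (Rmin d1 d2) (eps / 2 / M)).
  { destruct d1; simpl; repeat apply Rmin_pos; trivial.
    now apply Rdiv_lt_0_compat. }
  exists (mkposreal _ Hd); simpl; intros p' q' Hp' Hq'.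
  apply Rmin_Rgt_l in Hp'; destruct Hp' as [Hp' HpM].
  apply Rmin_Rgt_l in Hp'; destruct Hp' as [Hp1 _].
  apply Rmin_Rgt_l in Hq'; destruct Hq' as [Hq' _].
  apply Rmin_Rgt_l in Hq'; destruct Hq' as [Hq1 Hq2].
  destruct (MVT_gen (fun p => A p q') p p' (fun p => a p q')) as [m [Hm E]].
  { intros; apply HA. }
  { intros x _; apply continuity_pt_filterlim.
    apply (ex_derive_continuous (V := R_NormedModule) (fun p => A p q')).
    eexists; apply HA. }
  assert (Hmp : Rabs (m - p) <= Rabs (p' - p)).
  { revert Hm; unfold Rmin, Rmax, Rabs.
    destruct (Rle_dec p p'), (Rcase_abs (m - p)), (Rcase_abs (p' - p)); lra. }
  assert (Ham : Rabs (a m q') <= M).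
  { assert (H0 : Rabs (a m q' - a p q) < 1) by (apply H1; lra).
    assert (H3 := Rabs_triang_inv (a m q') (a p q)); unfold M; lra. }
  assert (Hfirst : Rabs (A p' q' - A p q') < eps / 2).
  { rewrite E, Rabs_mult.
    apply Rle_lt_trans with (M * Rabs (p' - p)).
    - apply Rmult_le_compat_r; [apply Rabs_pos | trivial].
    - apply Rlt_div_r in HpM; [|trivial]; lra. }
  assert (Hsecond : Rabs (A p q' - A p q) < eps / 2).
  { destruct (Req_dec q q') as [<-|Hne].
    - now rewrite Rminus_diag, Rabs_R0.
    - apply H2; repeat split; trivial. }
  replace (A p' q' - A p q) with ((A p' q' - A p q') + (A p q' - A p q)) by ring.
  eapply Rle_lt_trans; [apply Rabs_triang|]; lra.
Qed.

(** * Uniqueness in the coordinates of the two rays *)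

Lemma continuous_slice_l (F : R -> R -> R) (q : R) :
  (forall p q, continuous (fun z : R * R => F (fst z) (snd z)) (p, q)) ->
  forall s, continuous (fun s => F s q) s.
Proof.
  intros HF s.
  apply (continuous_comp_2 (fun s : R => s) (fun _ => q) F);
    [apply continuous_id | apply continuous_const | apply HF].
Qed.

Lemma continuous_slice_r (F : R -> R -> R) (p : R) :
  (forall p q, continuous (fun z : R * R => F (fst z) (snd z)) (p, q)) ->
  forall s, continuous (fun s => F p s) s.
Proof.
  intros HF s.
  apply (continuous_comp_2 (fun _ => p) (fun s : R => s) F);
    [apply continuous_const | apply continuous_id | apply HF].
Qed.

Definition opposite_moments (k : nat) (Phi Psi : R -> R -> R) (B : R) : Prop :=
  forall p q, tail_moment k (fun s => Phi s q) B p
            + tail_moment k (fun s => Psi p s) B q = 0.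

(** U k and V k below are the transforms of order k of Phi and Psi, with U k = - V k.
    The gradient of U 1 is (- U 0, V 0) = (- U 0, - U 0), so U 1 is constant in the
    direction (1, -1). *)
Lemma opposite_moments_eq_0 (Phi Psi : R -> R -> R) (B : R) :
  (forall p q, continuous (fun z : R * R => Phi (fst z) (snd z)) (p, q)) ->
  (forall p q, continuous (fun z : R * R => Psi (fst z) (snd z)) (p, q)) ->
  (forall p q, B <= p -> Phi p q = 0) ->
  opposite_moments 0 Phi Psi B ->
  opposite_moments 1 Phi Psi B ->
  forall p q, Phi p q = 0 /\ Psi p q = 0.
Proof.
  intros Phi_cont Psi_cont Phi_eq_0 H0 H1.
  set (U := fun k p q => tail_moment k (fun s => Phi s q) B p).
  set (V := fun k p q => tail_moment k (fun s => Psi p s) B q).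
  assert (HU0 : forall p q, U 0%nat p q = - V 0%nat p q).
  { intros p q; assert (E := H0 p q); unfold U, V; lra. }
  assert (HU1 : forall p q, U 1%nat p q = - V 1%nat p q).
  { intros p q; assert (E := H1 p q); unfold U, V; lra. }
  assert (DU0 : forall p q, is_derive (fun p => U 0%nat p q) p (- Phi p q)).
  { intros p q; apply (is_derive_tail_moment_0 (fun s => Phi s q)).
    now apply continuous_slice_l. }
  assert (DV0 : forall p q, is_derive (fun q => V 0%nat p q) q (- Psi p q)).
  { intros p q; apply (is_derive_tail_moment_0 (fun s => Psi p s)).
    now apply continuous_slice_r. }
  assert (DU1 : forall p q, is_derive (fun p => U 1%nat p q) p (- U 0%nat p q)).
  { intros p q; apply (is_derive_tail_moment_1 (fun s => Phi s q)).
    now apply continuous_slice_l. }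
  assert (DV1 : forall p q, is_derive (fun q => V 1%nat p q) q (- V 0%nat p q)).
  { intros p q; apply (is_derive_tail_moment_1 (fun s => Psi p s)).
    now apply continuous_slice_r. }
  assert (DU1q : forall p q, is_derive (fun q => U 1%nat p q) q (- U 0%nat p q)).
  { intros p q; apply (is_derive_ext (fun q => - V 1%nat p q)).
    - intros t; symmetry; apply HU1.
    - evar_last; [apply (is_derive_opp (V := R_NormedModule)), DV1|].
      rewrite HU0; unfold opp; simpl; ring. }
  assert (CU0 : forall p q,
    continuous (fun z : R * R => - U 0%nat (fst z) (snd z)) (p, q)).
  { intros p q; apply (continuous_opp (V := R_NormedModule)).
    apply (continuous_of_partial (U 0%nat) (fun p q => - Phi p q)); [apply DU0| |].
    - apply (continuous_opp (V := R_NormedModule)), Phi_cont.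
    - apply (continuous_ext (fun q => - V 0%nat p q)).
      + intros t; symmetry; apply HU0.
      + apply (continuous_opp (V := R_NormedModule)).
        apply (ex_derive_continuous (V := R_NormedModule)).
        eexists; apply DV0. }
  assert (EU1 : forall p q, U 1%nat p q = 0).
  { apply (eq_0_of_constant_direction (U 1%nat) (fun p q => - U 0%nat p q)
             (fun p q => - U 0%nat p q) (-1) B); trivial.
    - intros; ring.
    - intros p q Hp; apply tail_moment_eq_0; trivial.
      intros; now apply Phi_eq_0. }
  assert (EU0 : forall p q, U 0%nat p q = 0).
  { intros p q.
    assert (E := is_derive_of_zero _ _ _ (fun p => EU1 p q) (DU1 p q)); lra. }
  assert (EV0 : forall p q, V 0%nat p q = 0).
  { intros p q; assert (E := HU0 p q); rewrite EU0 in E; lra. }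
  intros p q; split.
  - assert (E := is_derive_of_zero _ _ _ (fun p => EU0 p q) (DU0 p q)); lra.
  - assert (E := is_derive_of_zero _ _ _ (fun q => EV0 p q) (DV0 p q)); lra.
Qed.

(** The gradient of the transform U 0 is (- Phi, Psi) = (- Phi, Phi), so U 0 is
    constant in the direction (1, 1). *)
Lemma opposite_integrals_eq_0 (Phi Psi : R -> R -> R) (B : R) :
  (forall p q, continuous (fun z : R * R => Phi (fst z) (snd z)) (p, q)) ->
  (forall p q, continuous (fun z : R * R => Psi (fst z) (snd z)) (p, q)) ->
  (forall p q, B <= p -> Phi p q = 0) ->
  opposite_moments 0 Phi Psi B ->
  (forall p q, Phi p q = Psi p q) ->
  forall p q, Phi p q = 0.
Proof.
  intros Phi_cont Psi_cont Phi_eq_0 H0 HPP.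
  set (U := fun k p q => tail_moment k (fun s => Phi s q) B p).
  set (V := fun k p q => tail_moment k (fun s => Psi p s) B q).
  assert (DU0 : forall p q, is_derive (fun p => U 0%nat p q) p (- Phi p q)).
  { intros p q; apply (is_derive_tail_moment_0 (fun s => Phi s q)).
    now apply continuous_slice_l. }
  assert (EU0 : forall p q, U 0%nat p q = 0).
  { apply (eq_0_of_constant_direction (U 0%nat) (fun p q => - Phi p q) Phi 1 B).
    - apply DU0.
    - intros p q; apply (is_derive_ext (fun q => - V 0%nat p q)).
      + intros t; assert (E := H0 p t); unfold U, V; lra.
      + evar_last.
        * apply (is_derive_opp (V := R_NormedModule)).
          apply (is_derive_tail_moment_0 (fun s => Psi p s)).
          now apply continuous_slice_r.
        * rewrite HPP; unfold opp; simpl; ring.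
    - intros; apply (continuous_opp (V := R_NormedModule)), Phi_cont.
    - intros; ring.
    - intros p q Hp; apply tail_moment_eq_0; trivial.
      intros; now apply Phi_eq_0. }
  intros p q.
  assert (E := is_derive_of_zero _ _ _ (fun p => EU0 p q) (DU0 p q)); lra.
Qed.

(** * From the plane to the coordinates of the two rays *)

(** What the proof retains of membership in [C2c]. *)
Definition continuous_in_disc (r : R) (h : R * R -> R) : Prop :=
  (forall x, continuous h x) /\ (forall x, r <= norm x -> h x = 0).

Lemma C2c_continuous_in_disc (r : R) (h : R * R -> R) :
  C2c (open_disc r) h -> continuous_in_disc r h.
Proof.
  intros [HC [_ Hs]]; split.
  - intros [x1 x2].
    destruct (HC x1 x2) as [Hc _].
    apply continuity_2d_pt_filterlim in Hc.
    apply (continuous_ext (fun z : R * R => h (fst z, snd z))); [|exact Hc].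
    now intros [z1 z2].
  - intros x Hx.
    destruct (Req_dec (h x) 0) as [E|N]; [exact E|exfalso].
    apply (Rlt_not_le _ _ (Hs x (fun H => locally_singleton _ _ H N)) Hx).
Qed.

Lemma continuous_in_disc_pairing (r : R) (f : R * R -> sym2) (w : sym2) :
  C2c_tensor (open_disc r) f ->
  continuous_in_disc r (fun x => pairing (f x) w).
Proof.
  intros [H11 [H12 H22]].
  apply C2c_continuous_in_disc in H11, H12, H22.
  destruct H11 as [C11 Z11], H12 as [C12 Z12], H22 as [C22 Z22]; split.
  - intros x; unfold pairing.
    apply (continuous_plus (V := R_NormedModule)
             (fun x => t11 (f x) * t11 w + 2 * (t12 (f x) * t12 w))
             (fun x => t22 (f x) * t22 w)).
    apply (continuous_plus (V := R_NormedModule)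
             (fun x => t11 (f x) * t11 w) (fun x => 2 * (t12 (f x) * t12 w))).
    + apply (continuous_mult (K := R_AbsRing) (fun x => t11 (f x)) (fun _ => t11 w));
        [apply C11 | apply continuous_const].
    + apply (continuous_mult (K := R_AbsRing) (fun _ => 2) (fun x => t12 (f x) * t12 w));
        [apply continuous_const|].
      apply (continuous_mult (K := R_AbsRing) (fun x => t12 (f x)) (fun _ => t12 w));
        [apply C12 | apply continuous_const].
    + apply (continuous_mult (K := R_AbsRing) (fun x => t22 (f x)) (fun _ => t22 w));
        [apply C22 | apply continuous_const].
  - intros x Hx; unfold pairing; rewrite Z11, Z12, Z22 by trivial; ring.
Qed.

Definition det (u v : R * R) : R := fst u * snd v - snd u * fst v.

Definition point (u v : R * R) (p q : R) : R * R := plus (scal p u) (scal q v).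

Lemma point_surj (u v x : R * R) :
  det u v <> 0 -> exists p q, x = point u v p q.
Proof.
  intros HD; exists (det x v / det u v), (det u x / det u v).
  destruct u as [u1 u2], v as [v1 v2], x as [x1 x2]; unfold det in *; simpl in *.
  apply injective_projections; unfold point; repeat (progress (unfold plus, scal; simpl));
    unfold mult; simpl; field; trivial.
Qed.

Lemma point_swap (u v : R * R) (p q : R) : point u v p q = point v u q p.
Proof. apply plus_comm. Qed.

(** Cramer: the coordinate p of p u + q v is det (p u + q v, v) / det (u, v), so a
    bound on this determinant keeps bounded sets bounded in coordinates. *)
Lemma det_le_norm (x v : R * R) :
  Rabs (det x v) <= norm x * (Rabs (fst v) + Rabs (snd v)).
Proof.
  destruct x as [x1 x2], v as [v1 v2]; unfold det; simpl fst; simpl snd.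
  destruct (norm_prod x1 x2) as [H _].
  assert (H1 := Rle_trans _ _ _ (Rmax_l _ _) H).
  assert (H2 := Rle_trans _ _ _ (Rmax_r _ _) H).
  change (norm x1) with (Rabs x1) in H1; change (norm x2) with (Rabs x2) in H2.
  unfold Rminus; eapply Rle_trans; [apply Rabs_triang|].
  rewrite Rabs_Ropp, !Rabs_mult.
  assert (Hv1 := Rabs_pos v1); assert (Hv2 := Rabs_pos v2).
  rewrite Rmult_plus_distr_l, Rplus_comm.
  apply Rplus_le_compat; now apply Rmult_le_compat_r.
Qed.

Lemma norm_point_ge (u v : R * R) (r : R) :
  det u v <> 0 ->
  exists B, forall p q, B <= p -> r <= norm (point u v p q).
Proof.
  intros HD.
  apply Rabs_pos_lt in HD.
  set (c := Rabs (fst v) + Rabs (snd v)).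
  assert (Hc : 0 <= c) by (apply Rplus_le_le_0_compat; apply Rabs_pos).
  exists (Rabs r * c / Rabs (det u v) + 1); intros p q Hp.
  set (x := point u v p q).
  destruct (Rle_lt_dec r (norm x)) as [H|H]; trivial; exfalso.
  assert (E : det x v = p * det u v).
  { unfold x, point, det; repeat (progress (unfold plus, scal; simpl)).
    unfold mult; simpl; ring. }
  assert (H1 := det_le_norm x v); fold c in H1.
  rewrite E, Rabs_mult in H1.
  assert (H2 : norm x * c <= Rabs r * c).
  { apply Rmult_le_compat_r; trivial; assert (H3 := Rle_abs r); lra. }
  assert (H3 : Rabs r * c / Rabs (det u v) < Rabs p) by (assert (H4 := Rle_abs p); lra).
  apply Rlt_div_l in H3; trivial; lra.
Qed.

Lemma continuous_at_point (u v : R * R) (h : R * R -> R) :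
  (forall x, continuous h x) ->
  forall p q, continuous (fun z : R * R => h (point u v (fst z) (snd z))) (p, q).
Proof.
  intros Hh p q.
  apply (continuous_comp (fun z : R * R => point u v (fst z) (snd z)) h); [|apply Hh].
  apply (continuous_plus (V := prod_NormedModule _ R_NormedModule R_NormedModule)
           (fun z : R * R => scal (fst z) u) (fun z : R * R => scal (snd z) v)).
  - apply (continuous_scal_l (V := prod_NormedModule _ R_NormedModule R_NormedModule)
             (fun z : R * R => fst z) u).
    apply continuous_fst.
  - apply (continuous_scal_l (V := prod_NormedModule _ R_NormedModule R_NormedModule)
             (fun z : R * R => snd z) v).
    apply continuous_snd.
Qed.

(** * V-line transforms *)

(** The common shape of [Ltrans], [Ttrans] and [Mtrans], which are convertible to
    instances of it. *)
Definition Vline (k : nat) (u v : R * R) (phi psi : R * R -> R) (x : R * R) : R :=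
  Xray k u phi x + Xray k v psi x.

(** A single bound B is used for all orders k, so that the moments of order 0 and 1
    are taken over the same interval. *)
Lemma opposite_moments_of_Vline (u v : R * R) (r : R) (phi1 phi2 psi1 psi2 : R * R -> R) :
  det u v <> 0 ->
  continuous_in_disc r phi1 -> continuous_in_disc r phi2 ->
  continuous_in_disc r psi1 -> continuous_in_disc r psi2 ->
  let Phi := fun p q => phi1 (point u v p q) - phi2 (point u v p q) in
  let Psi := fun p q => psi1 (point u v p q) - psi2 (point u v p q) in
  exists B,
    (forall p q, B <= p -> Phi p q = 0) /\
    forall k,
      (forall x, Vline k u v phi1 psi1 x = Vline k u v phi2 psi2 x) ->
      opposite_moments k Phi Psi B.
Proof.
  intros HD [Cp1 Zp1] [Cp2 Zp2] [Cs1 Zs1] [Cs2 Zs2] Phi Psi.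
  destruct (norm_point_ge u v r HD) as [Bu HBu].
  assert (HD' : det v u <> 0).
  { intros E; apply HD; unfold det in *; lra. }
  destruct (norm_point_ge v u r HD') as [Bv HBv].
  exists (Rmax Bu Bv).
  assert (Hl := Rmax_l Bu Bv); assert (Hr := Rmax_r Bu Bv).
  set (B := Rmax Bu Bv) in *; clearbody B.
  assert (Ru : forall p q, B <= p -> r <= norm (plus (scal q v) (scal p u))).
  { intros p q Hp; rewrite plus_comm; apply HBu; lra. }
  assert (Rv : forall p q, B <= q -> r <= norm (plus (scal p u) (scal q v))).
  { intros p q Hq; rewrite plus_comm; apply HBv; lra. }
  split.
  - intros p q Hp; unfold Phi; rewrite Zp1, Zp2 by (apply HBu; lra); ring.
  - intros k HV p q.
    assert (E := HV (point u v p q)); unfold Vline in E.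
    assert (EU : tail_moment k (fun s => Phi s q) B p =
      Xray k u phi1 (point u v p q) - Xray k u phi2 (point u v p q)).
    { rewrite point_swap; unfold point; rewrite <- (Xray_line_minus k phi1 phi2 _ u B p); auto.
      unfold tail_moment; apply RInt_ext; intros s _; unfold Phi.
      now rewrite point_swap. }
    assert (EV : tail_moment k (fun s => Psi p s) B q =
      Xray k v psi1 (point u v p q) - Xray k v psi2 (point u v p q)).
    { unfold point; rewrite <- (Xray_line_minus k psi1 psi2 _ v B q); auto. }
    rewrite EU, EV; lra.
Qed.

Lemma Vline_moments_inj (u v : R * R) (r : R) (phi1 phi2 psi1 psi2 : R * R -> R) :
  det u v <> 0 ->
  continuous_in_disc r phi1 -> continuous_in_disc r phi2 ->
  continuous_in_disc r psi1 -> continuous_in_disc r psi2 ->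
  (forall x, Vline 0 u v phi1 psi1 x = Vline 0 u v phi2 psi2 x) ->
  (forall x, Vline 1 u v phi1 psi1 x = Vline 1 u v phi2 psi2 x) ->
  forall x, phi1 x = phi2 x /\ psi1 x = psi2 x.
Proof.
  intros HD Hp1 Hp2 Hs1 Hs2 V0 V1 x.
  destruct (opposite_moments_of_Vline u v r phi1 phi2 psi1 psi2)
    as [B [HB HV]]; trivial.
  destruct (point_surj u v x HD) as [p [q ->]].
  destruct (opposite_moments_eq_0
    (fun p q => phi1 (point u v p q) - phi2 (point u v p q))
    (fun p q => psi1 (point u v p q) - psi2 (point u v p q)) B) with p q as [E F];
    auto; [| |split; lra].
  - intros; apply (continuous_minus (V := R_NormedModule));
      apply continuous_at_point; [apply Hp1 | apply Hp2].
  - intros; apply (continuous_minus (V := R_NormedModule));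
      apply continuous_at_point; [apply Hs1 | apply Hs2].
Qed.

Lemma Vline_inj_of_equal_weights (u v : R * R) (r : R)
    (phi1 phi2 psi1 psi2 : R * R -> R) :
  det u v <> 0 ->
  continuous_in_disc r phi1 -> continuous_in_disc r phi2 ->
  continuous_in_disc r psi1 -> continuous_in_disc r psi2 ->
  (forall x, Vline 0 u v phi1 psi1 x = Vline 0 u v phi2 psi2 x) ->
  (forall x, phi1 x - phi2 x = psi1 x - psi2 x) ->
  forall x, phi1 x = phi2 x.
Proof.
  intros HD Hp1 Hp2 Hs1 Hs2 V0 Hd x.
  destruct (opposite_moments_of_Vline u v r phi1 phi2 psi1 psi2)
    as [B [HB HV]]; trivial.
  destruct (point_surj u v x HD) as [p [q ->]].
  apply Rminus_diag_uniq.
  apply (opposite_integrals_eq_0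
    (fun p q => phi1 (point u v p q) - phi2 (point u v p q))
    (fun p q => psi1 (point u v p q) - psi2 (point u v p q)) B); auto.
  - intros; apply (continuous_minus (V := R_NormedModule));
      apply continuous_at_point; [apply Hp1 | apply Hp2].
  - intros; apply (continuous_minus (V := R_NormedModule));
      apply continuous_at_point; [apply Hs1 | apply Hs2].
Qed.

(** Two moments of the pair of weights (a, b) kill both components of f - g. If
    this forces equal components along c and d, one integral of the pair (c, d)
    kills them too; it remains to solve three linear equations. *)
Lemma sym2_recovery (u v : R * R) (r : R) (a b c d : sym2) (f g : R * R -> sym2) :
  det u v <> 0 ->
  C2c_tensor (open_disc r) f -> C2c_tensor (open_disc r) g ->
  (forall t, pairing t a = 0 -> pairing t b = 0 -> pairing t c = pairing t d) ->
  (forall t, pairing t a = 0 -> pairing t b = 0 -> pairing t c = 0 ->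
     t = Sym2 0 0 0) ->
  (forall k, (k <= 1)%nat -> forall x,
     Vline k u v (fun y => pairing (f y) a) (fun y => pairing (f y) b) x =
     Vline k u v (fun y => pairing (g y) a) (fun y => pairing (g y) b) x) ->
  (forall x,
     Vline 0 u v (fun y => pairing (f y) c) (fun y => pairing (f y) d) x =
     Vline 0 u v (fun y => pairing (g y) c) (fun y => pairing (g y) d) x) ->
  forall x, f x = g x.
Proof.
  intros HD Hf Hg Hcd Hzero V1 V2.
  set (t := fun x => Sym2 (t11 (f x) - t11 (g x)) (t12 (f x) - t12 (g x))
                          (t22 (f x) - t22 (g x))).
  assert (Ht : forall x w, pairing (t x) w = pairing (f x) w - pairing (g x) w).
  { intros; unfold pairing, t; simpl; ring. }
  assert (Hab : forall x, pairing (t x) a = 0 /\ pairing (t x) b = 0).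
  { intros x.
    destruct (Vline_moments_inj u v r _ _ _ _ HD
      (continuous_in_disc_pairing r f a Hf) (continuous_in_disc_pairing r g a Hg)
      (continuous_in_disc_pairing r f b Hf) (continuous_in_disc_pairing r g b Hg)
      (V1 0%nat (le_S _ _ (le_n _))) (V1 1%nat (le_n _)) x) as [E F].
    rewrite !Ht; lra. }
  assert (Hc : forall x, pairing (t x) c = 0).
  { intros x; rewrite Ht; apply Rminus_diag_eq; revert x.
    apply (Vline_inj_of_equal_weights u v r _ _ _ _ HD
      (continuous_in_disc_pairing r f c Hf) (continuous_in_disc_pairing r g c Hg)
      (continuous_in_disc_pairing r f d Hf) (continuous_in_disc_pairing r g d Hg) V2).
    intros x; rewrite <- !Ht; apply Hcd; apply Hab. }
  intros x.
  assert (E := Hzero (t x) (proj1 (Hab x)) (proj2 (Hab x)) (Hc x)).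
  injection E; destruct (f x), (g x); simpl; intros; f_equal; lra.
Qed.

(** * Recovery of the tensor field *)

Lemma Rmult_eq_0_cancel_l (x y : R) : x <> 0 -> x * y = 0 -> y = 0.
Proof.
  intros Hx E; apply Rmult_integral in E; destruct E; [contradiction | trivial].
Qed.

(** The sum of the two mixed components is a multiple of
    (u1^2 - u2^2) t12 and their difference one of u1 u2 (t11 - t22): this is
    where orthogonal rays, u1 = u2, lose information. *)
Lemma isotropic_of_mixed_eq_0 (u1 u2 : R) (t : sym2) :
  let u := (u1, u2) in
  let v := (- u1, u2) in
  0 < u1 * u2 -> u1 * u1 - u2 * u2 <> 0 ->
  pairing t (odot u (perp u)) = 0 -> pairing t (odot v (perp v)) = 0 ->
  t12 t = 0 /\ t22 t = t11 t.
Proof.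
  destruct t as [a b c]; unfold pairing, odot, perp; simpl; intros H12 Hdiff Ea Eb.
  assert (Hb : b = 0) by (apply (Rmult_eq_0_cancel_l (u1 * u1 - u2 * u2)); lra).
  split; [exact Hb|]; subst b.
  assert (Hc : c - a = 0) by (apply (Rmult_eq_0_cancel_l (u1 * u2)); lra).
  lra.
Qed.

Theorem theorem8 (r1 u1 u2 : R) (hr1 : 0 < r1)
    (hu1 : 0 < u1) (hu2 : 0 < u2) (hunit : norm (u1, u2) = 1)
    (hne : u1 <> u2) :
  let u := (u1, u2) in
  let v := (- u1, u2) in
  forall f g : R * R -> sym2,
    C2c_tensor (open_disc r1) f -> C2c_tensor (open_disc r1) g ->
    ((forall x, Ttrans 0 u v f x = Ttrans 0 u v g x) ->
     (forall x, Ttrans 1 u v f x = Ttrans 1 u v g x) ->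
     (forall x, Ltrans 0 u v f x = Ltrans 0 u v g x) ->
     forall x, f x = g x) /\
    ((forall x, Mtrans 0 u v f x = Mtrans 0 u v g x) ->
     (forall x, Mtrans 1 u v f x = Mtrans 1 u v g x) ->
     (forall x, Ltrans 0 u v f x = Ltrans 0 u v g x) ->
     forall x, f x = g x) /\
    ((forall x, Mtrans 0 u v f x = Mtrans 0 u v g x) ->
     (forall x, Mtrans 1 u v f x = Mtrans 1 u v g x) ->
     (forall x, Ttrans 0 u v f x = Ttrans 0 u v g x) ->
     forall x, f x = g x).
Proof.
  intros u v f g Hf Hg.
  assert (HD : det u v <> 0).
  { unfold det, u, v; simpl; assert (H := Rmult_lt_0_compat _ _ hu1 hu2); lra. }
  assert (H12 : 0 < u1 * u2) by now apply Rmult_lt_0_compat.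
  assert (Hdiff : u1 * u1 - u2 * u2 <> 0).
  { intros E; apply hne; nra. }
  assert (Hsum : 0 < u1 * u1 + u2 * u2) by nra.
  assert (Hle : forall P : nat -> Prop, P 0%nat -> P 1%nat -> forall k, (k <= 1)%nat -> P k).
  { intros P P0 P1 [|[|k]] Hk; trivial; inversion Hk as [|? Hk']; inversion Hk'. }
  split; [|split]; intros H0 H1 H2;
    (eapply (sym2_recovery u v r1); [exact HD | exact Hf | exact Hg | | |
       refine (Hle _ _ _); [exact H0 | exact H1] | exact H2]);
    intros [a b c]; unfold pairing, odot, perp, u, v; simpl.
  - intros Ea Eb.
    assert (Hb : b = 0) by (apply (Rmult_eq_0_cancel_l (u1 * u2)); lra).
    rewrite Hb; ring.
  - intros Ea Eb Ec.
    assert (Hb : b = 0) by (apply (Rmult_eq_0_cancel_l (u1 * u2)); lra).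
    subst b.
    assert (E : u2 * u2 * a + u1 * u1 * c = 0) by lra.
    assert (F : u1 * u1 * a + u2 * u2 * c = 0) by lra.
    assert (Ha : a = 0).
    { apply (Rmult_eq_0_cancel_l (u1 * u1 + u2 * u2)); [lra|].
      apply (Rmult_eq_0_cancel_l (u1 * u1 - u2 * u2)); [trivial|].
      replace ((u1 * u1 - u2 * u2) * ((u1 * u1 + u2 * u2) * a))
        with (u1 * u1 * (u1 * u1 * a + u2 * u2 * c)
              - u2 * u2 * (u2 * u2 * a + u1 * u1 * c)) by ring.
      rewrite E, F; ring. }
    subst a; f_equal.
    apply (Rmult_eq_0_cancel_l (u1 * u1)); [nra | lra].
  - intros Ea Eb.
    destruct (isotropic_of_mixed_eq_0 u1 u2 (Sym2 a b c) H12 Hdiff Ea Eb) as [Hb _].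
    simpl in Hb; rewrite Hb; ring.
  - intros Ea Eb Ec.
    destruct (isotropic_of_mixed_eq_0 u1 u2 (Sym2 a b c) H12 Hdiff Ea Eb) as [Hb Hac].
    simpl in Hb, Hac; subst b c.
    assert (Ha : a = 0) by (apply (Rmult_eq_0_cancel_l (u1 * u1 + u2 * u2)); lra).
    now subst a.
  - intros Ea Eb.
    destruct (isotropic_of_mixed_eq_0 u1 u2 (Sym2 a b c) H12 Hdiff Ea Eb) as [Hb _].
    simpl in Hb; rewrite Hb; ring.
  - intros Ea Eb Ec.
    destruct (isotropic_of_mixed_eq_0 u1 u2 (Sym2 a b c) H12 Hdiff Ea Eb) as [Hb Hac].
    simpl in Hb, Hac; subst b c.
    assert (Ha : a = 0) by (apply (Rmult_eq_0_cancel_l (u1 * u1 + u2 * u2)); lra).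
    now subst a.
Qed.
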